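(* Let $\mathsf{f}\in\mathbb{R}^n$ and let $\mathsf{p}\in\mathbb{R}^n$ be a probability vector with $p_i>0$ for all $i$. For $\varepsilon\ge0$ let $$V_{\rm b}(\varepsilon)=\max\Big\{\sum_{i=1}^nq_if_i\ \Big|\ \mathsf{q}\in\mathbb{R}^n,\ \sum_{i=1}^nq_i=1,\ 0\le q_i\le(1+\varepsilon)p_i\ (i=1,\dots,n)\Big\}.$$ Then $$\lim_{\varepsilon\downarrow0}\frac{V_{\rm b}(\varepsilon)-V_{\rm b}(0)}{\varepsilon}=\mathbb{E}_{\mathsf{p}}(\mathsf{f})-\min(\mathsf{f}).$$
   Context: $\mathbb{E}_{\mathsf{p}}(\mathsf{f})=\sum_ip_if_i$ and $\min(\mathsf{f})=\min_if_i$. The limit is the worst-case sensitivity $\mathcal{S}_{\mathsf{p}}(\mathsf{f})$ for the ''budgeted'' uncertainty set with growth function $g(\varepsilon)=\varepsilon$. *)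

(* Defs.v *)
From mathcomp Require Import all_boot all_order all_algebra.
From mathcomp Require Import all_classical all_reals all_analysis.

Set Implicit Arguments.
Unset Strict Implicit.
Unset Printing Implicit Defensive.

Import Order.TTheory GRing.Theory Num.Theory.
Import numFieldNormedType.Exports.

Local Open Scope classical_set_scope.
Local Open Scope ring_scope.

(* The greatest/least element of a set of reals; the value is 0 when there is
   none (see budget_value_max and vec_minP: this case does not occur below). *)
Definition set_max (R : realType) (A : set R) : R := xget 0 (A `&` ubound A).
Definition set_min (R : realType) (A : set R) : R := xget 0 (A `&` lbound A).

Definition prob_vector (R : realType) (n : nat) (p : 'rV[R]_n) : Prop :=
  (forall i, 0 <= p 0 i) /\ \sum_(i < n) p 0 i = 1.

Definition expect (R : realType) (n : nat) (p f : 'rV[R]_n) : R :=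
  \sum_(i < n) p 0 i * f 0 i.

Definition vec_min (R : realType) (n : nat) (f : 'rV[R]_n) : R :=
  set_min (range (fun i => f 0 i)).

Definition budget_set (R : realType) (n : nat) (p : 'rV[R]_n) (eps : R) :
    set 'rV[R]_n :=
  [set q | \sum_(i < n) q 0 i = 1 /\
           forall i, 0 <= q 0 i <= (1 + eps) * p 0 i].

Definition budget_value (R : realType) (n : nat) (f p : 'rV[R]_n) (eps : R) : R :=
  set_max [set expect q f | q in budget_set p eps].

Lemma expect_continuous (R : realType) (n : nat) (f : 'rV[R]_n) :
  continuous (fun q : 'rV[R]_n => expect q f).
Proof.
apply: continuous_big => [|i _ q]; first exact: add_continuous.
have qi := @coord_continuous R 1 n 0 i q.
by apply: (cvgM qi); exact: cvg_cst.
Qed.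

Lemma budget_set_compact (R : realType) (n : nat) (p : 'rV[R]_n) (eps : R) :
  compact (budget_set p eps).
Proof.
have -> : budget_set p eps =
    [set q : 'rV[R]_n | forall i, `[0, (1 + eps) * p 0 i]%classic (q 0 i)] `&`
    (fun q : 'rV[R]_n => expect q (const_mx 1)) @^-1` [set 1].
  apply/seteqP; split => q /=.
    move=> [q1 qb]; split; first by move=> i; rewrite in_itv /= qb.
    by rewrite -[RHS]q1 /expect; apply: eq_bigr => i _; rewrite mxE mulr1.
  move=> [qb q1]; split; last by move=> i; have := qb i; rewrite in_itv.
  by rewrite -[RHS]q1 /expect; apply: eq_bigr => i _; rewrite mxE mulr1.
apply: compact_closedI.
  apply: (@rV_compact R n (fun i => `[0, (1 + eps) * p 0 i]%classic)) => i.
  exact: segment_compact.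
apply: (continuous_closedP _).1; first exact: expect_continuous.
exact: closed_eq.
Qed.

Lemma budget_value_max (R : realType) (n : nat) (f p : 'rV[R]_n) (eps : R) :
  prob_vector p -> 0 <= eps ->
  (exists2 q, budget_set p eps q & expect q f = budget_value f p eps) /\
  (forall q, budget_set p eps q -> expect q f <= budget_value f p eps).
Proof.
move=> [p0 p1] e0.
have bp : budget_set p eps p.
  by split => // i; rewrite p0 /= mulrDl mul1r lerDl mulr_ge0.
have [q bq qmax] : exists2 q, budget_set p eps q &
    forall t, budget_set p eps t -> expect t f <= expect q f.
  have [|||q] := @EVT_max_rV R n (fun q => expect q f) (budget_set p eps).
  - by exists p.
  - exact: budget_set_compact.
  - by apply: continuous_subspaceT; exact: expect_continuous.
  - rewrite inE => bq qmax; exists q => // t bt.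
    by apply: qmax; rewrite inE.
set A := [set expect q f | q in budget_set p eps].
have [Am Au] : (A `&` ubound A) (budget_value f p eps).
  apply: xgetPex; exists (expect q f); split; first by exists q.
  by move=> _ [t bt <-]; exact: qmax.
by split => [//|t bt]; apply: Au; exists t.
Qed.

Lemma vec_minP (R : realType) (n : nat) (f : 'rV[R]_n) :
  (0 < n)%N ->
  (exists i, f 0 i = vec_min f) /\ (forall i, vec_min f <= f 0 i).
Proof.
move=> n0; set A := range (fun i => f 0 i).
have [Am Al] : (A `&` lbound A) (vec_min f).
  apply: xgetPex; pose i0 := Ordinal n0.
  have [j _ jmin] := arg_minP (fun i => f 0 i) (erefl : predT i0).
  exists (f 0 j); split; first by exists j.
  by move=> _ [i _ <-]; exact: jmin.
split; first by case: Am => i _ <-; exists i.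
by move=> i; apply: Al; exists i.
Qed.

(* Main.v *)
Require Import Defs.
From mathcomp Require Import all_boot all_order all_algebra.
From mathcomp Require Import all_classical all_reals all_analysis.
From mathcomp Require Import ring lra.
Import Order.TTheory GRing.Theory Num.Theory.
Import numFieldNormedType.Exports.
Local Open Scope classical_set_scope.
Local Open Scope ring_scope.

(* For small eps the maximum is explicit: mass eps is moved away from an index
   j where f is minimal, so the optimiser is (1 + eps) p - eps e_j, feasible as
   soon as eps <= p_j. Hence V(eps) = (1 + eps) E_p(f) - eps min f near 0, and
   the difference quotient is constant there. *)

Lemma expectBl (R : realType) (n : nat) (a b : R) (p q f : 'rV[R]_n) :
  expect (a *: p - b *: q) f = a * expect p f - b * expect q f.
Proof.
rewrite /expect !mulr_sumr -sumrB; apply: eq_bigr => i _.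
by rewrite !mxE; ring.
Qed.

Lemma expect_delta (R : realType) (n : nat) (f : 'rV[R]_n) (j : 'I_n) :
  expect (delta_mx 0 j) f = f 0 j.
Proof.
rewrite /expect (bigD1 j) //= big1 => [|i /negPf ij].
  by rewrite mxE !eqxx mul1r addr0.
by rewrite mxE ij andbF mul0r.
Qed.

Lemma expect_const1 (R : realType) (n : nat) (q : 'rV[R]_n) :
  expect q (const_mx 1) = \sum_(i < n) q 0 i.
Proof. by apply: eq_bigr => i _; rewrite mxE mulr1. Qed.

(** Weak duality: the slack [(1 + eps) * p 0 i - q 0 i] of the upper constraint and [f 0 i - m] are
    both nonnegative, so their products sum to a nonnegative number. *)
Lemma expect_budget_le (R : realType) (n : nat) (f p q : 'rV[R]_n) (eps m : R) :
  prob_vector p -> (forall i, m <= f 0 i) -> budget_set p eps q ->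
  expect q f <= (1 + eps) * expect p f - eps * m.
Proof.
move=> [_ p1] mf [q1 qb].
have : 0 <= \sum_(i < n) ((1 + eps) * p 0 i - q 0 i) * (f 0 i - m).
  apply: sumr_ge0 => i _; have /andP[_ qi] := qb i.
  by rewrite mulr_ge0 ?subr_ge0.
(* Both remaining sums equal 1, so the last bracket is [eps * m]. *)
have -> : \sum_(i < n) ((1 + eps) * p 0 i - q 0 i) * (f 0 i - m) =
    (1 + eps) * expect p f - expect q f
    - ((1 + eps) * m * (\sum_(i < n) p 0 i) - m * (\sum_(i < n) q 0 i)).
  rewrite /expect !mulr_sumr -!sumrB; apply: eq_bigr => i _; ring.
by rewrite p1 q1; lra.
Qed.

Lemma budget_set_shift (R : realType) (n : nat) (p : 'rV[R]_n) (eps : R)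
    (j : 'I_n) :
  prob_vector p -> 0 <= eps <= p 0 j ->
  budget_set p eps ((1 + eps) *: p - eps *: delta_mx 0 j).
Proof.
move=> [p0 p1] /andP[e0 ej]; split.
  (* Total mass is the expectation of the constant 1, so linearity gives [(1 + eps) - eps]. *)
  by rewrite -expect_const1 expectBl expect_delta expect_const1 p1 mxE; ring.
move=> i; have pi := p0 i; rewrite !mxE eqxx /=.
have epi : 0 <= eps * p 0 i by rewrite mulr_ge0.
(* Only entry [j] is lowered: it stays nonnegative because [eps <= p 0 j]. Every other entry sits at
   its upper bound. *)
case: eqP => [ij|_] /=; rewrite ?mulr1 ?mulr0.
  by subst i; apply/andP; split; lra.
by apply/andP; split; lra.
Qed.

Lemma budget_value_small (R : realType) (n : nat) (f p : 'rV[R]_n) (eps : R)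
    (j : 'I_n) :
  prob_vector p -> (forall i, f 0 j <= f 0 i) -> 0 <= eps <= p 0 j ->
  budget_value f p eps = (1 + eps) * expect p f - eps * f 0 j.
Proof.
move=> pp fj ej; have /andP[e0 _] := ej.
have [[q bq qV] qmax] := budget_value_max f pp e0.
apply/eqP; rewrite eq_le -{1}qV expect_budget_le //=.
(* For the lower bound, the formula is read back as the expectation of [f] under the shifted vector,
   which is feasible. *)
rewrite -(expect_delta _ _ f) -expectBl.
by rewrite (qmax _ (budget_set_shift _ _ _ _ _ pp ej)).
Qed.

Theorem proposition4p5 (R : realType) (n : nat) (f p : 'rV[R]_n)
    (p_prob : prob_vector p) (p_gt0 : forall i, 0 < p 0 i) :
  (budget_value f p eps - budget_value f p 0) / eps @[eps --> 0^'+]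
    --> expect p f - vec_min f.
Proof.
have n0 : (0 < n)%N.
  case: n f p p_prob p_gt0 => [f p [_]|//].
  by rewrite big_ord0 => /esym/eqP; rewrite oner_eq0.
have [[j fj] fmin] := vec_minP f n0.
rewrite -fj in fmin *.
apply: cvg_near_cst; near=> eps.
have e0 : 0 < eps by near: eps; exact: nbhs_right_gt.
(* Holds near 0 because [p 0 j] is positive. *)
have ej : eps <= p 0 j by near: eps; exact: nbhs_right_le.
(* The closed form applies both at [eps] and at 0. *)
rewrite !(@budget_value_small _ _ _ _ _ j) ?lexx ?(ltW e0) ?(ltW (p_gt0 j)) //.
by field; rewrite gt_eqF.
Unshelve. all: by end_near. Qed.
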